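(* Let $G$ be a finite group with unit element $e$, let $H$ be an abelian subgroup of $G$, and let $R=\mathbb{C}[x_g ; g\in G]$. Then for every $h\in H$ there exists a homogeneous polynomial $a_h\in R$ with $\deg a_h=[G:H]$ such that $$\Theta(G)\, e=\prod_{\chi\in\widehat{H}}\ \sum_{h\in H}\chi(h)\,a_h\,h ,$$ where the equality holds in the group algebra $RH$. Moreover, if $H$ is normal in $G$ and $h,h'\in H$ are conjugate in $G$, then $a_h=a_{h'}$.
   Context: $R=\mathbb{C}[x_g ; g\in G]$ is the polynomial ring over $\mathbb{C}$ in independent commuting variables $x_g$ indexed by the elements $g$ of $G$. $RH$ is the group algebra of $H$ over $R$. The group determinant of $G$ is $\Theta(G)=\det\left(x_{gh^{-1}}\right)_{g,h\in G}\in R$, the determinant of a $|G|\times|G|$ matrix. $\widehat{H}$ is a complete set of inequivalent irreducible representations of $H$ over $\mathbb{C}$; since $H$ is abelian these are the group homomorphisms $H\to\mathbb{C}^{\times}$. $[G:H]$ is the index of $H$ in $G$. *)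

(* Defs.v *)
From HB Require Import structures.
From mathcomp Require Import all_boot all_order all_algebra all_fingroup.
From mathcomp Require Import cyclic reals complex mpoly.

Set Implicit Arguments.
Unset Strict Implicit.
Unset Printing Implicit Defensive.

Import GRing.Theory.
Local Open Scope ring_scope.

(* The variable x_g.  {mpoly C[n]} has its variables indexed by 'I_n, so the
   elements of G are numbered by enum_rank, a bijection from G to 'I_#|G|.    *)
Definition gvar (C : nzRingType) (G : finGroupType) (g : G) : {mpoly C[#|G|]} :=
  'X_(enum_rank g).

Definition group_det (C : comNzRingType) (G : finGroupType) :
    {mpoly C[#|G|]} :=
  \det (\matrix_(i < #|G|, j < #|G|)
          gvar C (enum_val i * (enum_val j)^-1)%g).

Section GroupAlgebra.

Variables (A : comNzRingType) (K : finGroupType).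

(* The group algebra AK: the element \sum_x (f x) x is represented by its
   coefficient function f, and the product is the convolution product (not the
   pointwise product of functions).                                           *)
Definition galg : Type := {ffun K -> A}.

HB.instance Definition _ := GRing.Zmodule.copy galg {ffun K -> A}.

Implicit Types f g h : galg.

(* The group element x, seen in AK. *)
Definition gelt (x : K) : galg := [ffun y => (y == x)%:R].

Definition galg_mul f g : galg :=
  [ffun x => \sum_(y : K) f y * g (y^-1 * x)%g].

Definition galg_scale (a : A) f : galg := [ffun x => a * f x].

Lemma galg_mulA : associative galg_mul.
Proof.
move=> f g h; apply/ffunP=> x; rewrite !ffunE.
under eq_bigr do rewrite ffunE mulr_sumr.
under [RHS]eq_bigr do rewrite ffunE mulr_suml.
rewrite [RHS]exchange_big /=; apply: eq_bigr => y _.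
rewrite [RHS](reindex_inj (mulgI y)) /=; apply: eq_bigr => z _.
by rewrite mulrA mulKg invMg mulgA.
Qed.

Lemma galg_mul1l : left_id (gelt 1%g) galg_mul.
Proof.
move=> f; apply/ffunP=> x; rewrite ffunE (bigD1 1%g) //= ffunE eqxx mul1r.
rewrite invg1 mul1g big1 ?addr0 // => y /negPf y1.
by rewrite ffunE y1 mul0r.
Qed.

Lemma galg_mul1r : right_id (gelt 1%g) galg_mul.
Proof.
move=> f; apply/ffunP=> x; rewrite ffunE (bigD1 x) //= ffunE mulVg eqxx mulr1.
rewrite big1 ?addr0 // => y /negPf yx.
by rewrite ffunE -eq_mulVg1 yx mulr0.
Qed.

Lemma galg_mulDl : left_distributive galg_mul +%R.
Proof.
move=> f g h; apply/ffunP=> x; rewrite !ffunE -big_split /=.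
by apply: eq_bigr => y _; rewrite ffunE mulrDl.
Qed.

Lemma galg_mulDr : right_distributive galg_mul +%R.
Proof.
move=> f g h; apply/ffunP=> x; rewrite !ffunE -big_split /=.
by apply: eq_bigr => y _; rewrite ffunE mulrDr.
Qed.

Lemma galg_1neq0 : gelt 1%g != 0.
Proof.
by apply/eqP=> /ffunP/(_ 1%g)/eqP; rewrite !ffunE eqxx oner_eq0.
Qed.

HB.instance Definition _ := GRing.Zmodule_isNzRing.Build galg
  galg_mulA galg_mul1l galg_mul1r galg_mulDl galg_mulDr galg_1neq0.

Lemma galg_scaleA a b f : galg_scale a (galg_scale b f) = galg_scale (a * b) f.
Proof. by apply/ffunP=> x; rewrite !ffunE mulrA. Qed.

Lemma galg_scale1 : left_id 1 galg_scale.
Proof. by move=> f; apply/ffunP=> x; rewrite ffunE mul1r. Qed.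

Lemma galg_scaleDr : right_distributive galg_scale +%R.
Proof. by move=> a f g; apply/ffunP=> x; rewrite !ffunE mulrDr. Qed.

Lemma galg_scaleDl f : {morph galg_scale^~ f : a b / a + b}.
Proof. by move=> a b; apply/ffunP=> x; rewrite !ffunE mulrDl. Qed.

HB.instance Definition _ := GRing.Zmodule_isLmodule.Build A galg
  galg_scaleA galg_scale1 galg_scaleDr galg_scaleDl.

Lemma galg_scaleAl (a : A) f g : a *: (f * g) = (a *: f) * g.
Proof.
apply/ffunP=> x; rewrite !ffunE mulr_sumr.
by apply: eq_bigr => y _; rewrite ffunE mulrA.
Qed.

HB.instance Definition _ := GRing.Lmodule_isLalgebra.Build A galg galg_scaleAl.

Lemma galg_scaleAr (a : A) f g : a *: (f * g) = f * (a *: g).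
Proof.
apply/ffunP=> x; rewrite !ffunE mulr_sumr.
by apply: eq_bigr => y _; rewrite ffunE mulrCA.
Qed.

HB.instance Definition _ := GRing.Lalgebra_isAlgebra.Build A galg galg_scaleAr.

Lemma geltM (x y : K) : gelt (x * y)%g = gelt x * gelt y.
Proof.
apply/ffunP=> z; rewrite !ffunE (bigD1 x) //= !ffunE eqxx mul1r.
rewrite big1 ?addr0 => [|t /negPf tx]; last by rewrite ffunE tx mul0r.
by congr (_%:R); rewrite eq_sym (can2_eq (mulKg x) (mulKVg x)) eq_sym.
Qed.

Lemma galg_sum_gelt f : f = \sum_(x : K) f x *: gelt x.
Proof.
apply/ffunP=> y; rewrite sum_ffunE (bigD1 y) //= !ffunE eqxx mulr1.
rewrite big1 ?addr0 // => x /negPf xy.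
by rewrite !ffunE eq_sym xy mulr0.
Qed.

End GroupAlgebra.

Section Dual.

Variables (C : closedFieldType) (K : finGroupType).

(* Group homomorphisms from K to the multiplicative group of C; the values are
   nonzero because chi 1 = 1 and chi is multiplicative.  For abelian K these
   are the irreducible representations of K over C, one in each equivalence
   class.                                                                     *)
Definition is_char (chi : {ffun K -> C}) : bool :=
  (chi 1%g == 1) && [forall x, forall y, chi (x * y)%g == chi x * chi y].

Record dual := Dual { dual_val :> {ffun K -> C}; _ : is_char dual_val }.

HB.instance Definition _ := [isSub for dual_val].
HB.instance Definition _ := [Choice of dual by <:].

Lemma dual1 (chi : dual) : chi 1%g = 1.
Proof. by case: chi => /= chi /andP[/eqP]. Qed.

Lemma dualM (chi : dual) : {morph chi : x y / (x * y)%g >-> x * y}.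
Proof.
by case: chi => /= chi /andP[_ /forallP chiM] x y; apply/eqP/(forallP (chiM x)).
Qed.

Lemma dualX (chi : dual) x n : chi (x ^+ n)%g = chi x ^+ n.
Proof.
by elim: n => [|n IHn]; rewrite ?dual1 // expgS dualM IHn exprS.
Qed.

(* dual is a finite type: the values of chi are #|K|-th roots of unity. *)
Definition dual_roots : seq C :=
  sval (closed_field_poly_normal ('X^#|K| - 1 : {poly C})).

Lemma dual_rootsP (chi : dual) x : chi x \in dual_roots.
Proof.
rewrite /dual_roots; case: closed_field_poly_normal => /= r def_p.
have K_gt0 : (0 < #|K|)%N by apply/card_gt0P; exists 1%g.
rewrite -root_prod_XsubC.
have lp : lead_coef ('X^#|K| - 1 : {poly C}) = 1.
  by rewrite lead_coefDl ?lead_coefXn // size_polyXn size_polyN size_poly1.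
rewrite lp scale1r in def_p; rewrite -def_p.
have xK : (x ^+ #|K| = 1)%g.
  by rewrite -cardsT expg_cardG ?inE.
by rewrite rootE !hornerE -dualX xK dual1 subrr.
Qed.

Definition dual_code (chi : dual) : {ffun K -> seq_sub dual_roots} :=
  [ffun x => SeqSub (dual_rootsP chi x)].

Definition dual_decode (f : {ffun K -> seq_sub dual_roots}) : option dual :=
  insub [ffun x => ssval (f x)].

Lemma dual_codeK : pcancel dual_code dual_decode.
Proof.
move=> chi; rewrite /dual_decode -[RHS](valK chi); congr insub.
by apply/ffunP=> x; rewrite !ffunE.
Qed.

HB.instance Definition _ := Countable.copy dual (pcan_type dual_codeK).
HB.instance Definition _ : isFinite dual := PCanIsFinite dual_codeK.

End Dual.

(* Main.v *)
(** For a character chi of H and a left transversal t_1, ..., t_m of H, put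
    M_chi := (\sum_h chi(h) x_{t_i h t_j^-1})_{i,j} and D_chi := \det M_chi.
    Multiplying the group matrix, cut into m x m blocks indexed by H x H, by the
    character table of H block-diagonalises it, so \Theta(G) = \prod_chi D_chi.
    Let a_h be the inverse Fourier transform of chi |-> D_chi.  Evaluating the
    right-hand side of the theorem at a character psi gives
    \prod_chi D_(psi chi) = \Theta(G), and characters separate the elements of
    the group algebra.  To see that a_h != 0, specialise
    x_g to u [g = 1] - [g = h]: then D_chi becomes a characteristic polynomial
    in u, and the coefficient of u^(m-1) of a_h is minus the number of coset
    representatives commuting with h, a nonzero number.  If H is normal, D_chi
    is invariant under conjugation of chi because t_1 g, ..., t_m g is again a
    transversal. *)

Require Import Defs.
From mathcomp Require Import all_boot all_order all_algebra all_fingroup.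
From mathcomp Require Import cyclic separable cyclotomic reals complex mpoly.

Set Implicit Arguments.
Unset Strict Implicit.
Unset Printing Implicit Defensive.

Import GRing.Theory Num.Theory.
Local Open Scope group_scope.
Local Open Scope ring_scope.

(** * Homogeneous polynomials, diagonalisation and determinants *)

Lemma det_homog (n : nat) (R : comNzRingType) m (A : 'M[{mpoly R[n]}]_m) :
  (forall i j, A i j \is 1.-homog) -> \det A \is m.-homog.
Proof.
move=> homA; apply: rpred_sum => s _; rewrite -signr_odd mulr_sign.
suff homP : \prod_i A i (s i) \is (\sum_(i < m) 1%N).-homog.
  by rewrite sum1_card card_ord in homP; case: ifP; rewrite ?rpredN.
elim/big_rec2: _ => [|i d p _ homp]; first exact: dhomog1.
exact: dhomogM (homA _ _) homp.
Qed.

(** Zero is homogeneous of every degree, so the exact degree of a_h also requires a_h to be nonzero;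
    [msize] is the degree plus one. *)
Lemma msize_homog (n : nat) (R : nzRingType) d (p : {mpoly R[n]}) :
  p \is d.-homog -> p != 0 -> msize p = d.+1.
Proof.
move=> homp p_neq0; have := dhomog_uniq p_neq0 homp (dhomog_msize homp).
by move=> ->; rewrite prednK // lt0n msize_poly_eq0.
Qed.

Lemma poly_eq0_horner (R : numDomainType) (p : {poly R}) :
  (forall u, p.[u] = 0) -> p = 0.
Proof.
move=> p0; apply: contraTeq isT => p_neq0.
(* In characteristic 0 the integers below [size p] would be distinct roots, one too many. *)
have := max_poly_roots (rs := [seq i%:R | i <- iota 0 (size p)]) p_neq0.
rewrite size_map size_iota ltnn; apply.
  by apply/allP=> u _; rewrite rootE p0.
rewrite map_inj_uniq ?iota_uniq // => i j /eqP; rewrite eqr_nat.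
exact/eqP.
Qed.

Lemma horner_char_poly (R : comNzRingType) n (A : 'M[R]_n) u :
  (char_poly A).[u] = \det (u%:M - A).
Proof.
rewrite -horner_evalE -det_map_mx; congr (\det _).
by apply/matrixP=> i j; rewrite !mxE /= /horner_eval !hornerE hornerMn hornerX.
Qed.

(** The minimal polynomial divides X^k - 1, which has simple roots in characteristic 0. Iterating
    [mulmx] lets size 0 be included. *)
Lemma finite_order_diagonalizable (C : numClosedFieldType) k n (A : 'M[C]_n) :
  (0 < k)%N -> iter k (mulmx A) 1%:M = 1%:M -> diagonalizable A.
Proof.
case: n A => [|n] A k_gt0 Ak1.
  by exists 1%:M; rewrite ?unitmx1 //; apply/is_diag_mxP; case.
have [r def_r] := closed_field_poly_normal ('X^k - 1 : {poly C}).
rewrite lead_coefDl ?lead_coefXn ?scale1r in def_r; last first.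
  by rewrite size_polyXn size_polyN size_poly1.
apply/diagonalizableP; exists r.
  rewrite -separable_prod_XsubC -def_r separable_Xn_sub_1 //.
  by rewrite pnatr_eq0 -lt0n.
rewrite -def_r mxminpoly_min // rmorphB rmorph1 rmorphXn /= horner_mx_X.
suff <- : iter k (mulmx A) 1%:M = A ^+ k by rewrite Ak1 subrr.
by elim: (k) => // j /= ->; rewrite exprS.
Qed.

Lemma det_castmx (R : comNzRingType) m n (e : m = n) (A : 'M[R]_m) :
  \det (castmx (e, e) A) = \det A.
Proof. by case: n / e; rewrite castmx_id. Qed.

Lemma det_mxdiag (R : comNzRingType) n (p_ : 'I_n -> nat)
    (B_ : forall i, 'M[R]_(p_ i)) :
  \det (\mxdiag_i B_ i) = \prod_i \det (B_ i).
Proof.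
elim: n p_ B_ => [|n IHn] p_ B_.
  rewrite [RHS]big_ord0; move: (\mxdiag_i B_ i); rewrite big_ord0 => B.
  exact: det_mx00.
by rewrite mxdiag_recl [RHS]big_ord_recl -IHn det_castmx det_ublock.
Qed.

(** Renumbering rows and columns in the same way brings in the sign of one permutation twice. *)
Lemma det_mxsub_bij (R : comNzRingType) n m (A : 'M[R]_n) (f : 'I_m -> 'I_n) :
  bijective f -> \det (mxsub f f A) = \det A.
Proof.
move=> bij_f; have eq_mn: m = n by have := bij_eq_card bij_f; rewrite !card_ord.
case: n / eq_mn A f bij_f => A f /bij_inj inj_f.
have -> : mxsub f f A = row_perm (perm inj_f) (col_perm (perm inj_f) A).
  by apply/matrixP=> i j; rewrite !mxE !permE.
rewrite row_permE col_permE !det_mulmx !det_perm odd_permV mulrC -mulrA.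
by rewrite -signr_addb addbb mulr1.
Qed.

(** * Left transversals of a subgroup *)

Section Transversal.

Variables (G : finGroupType) (H : {group G}).

Lemma transversal_exists :
  exists t : 'I_#|[set: G] : H| -> G,
    bijective (fun p : 'I_#|[set: G] : H| * subg_of H => t p.1 * sgval p.2)%g.
Proof.
pose B (i : 'I_#|[set: G] : H|) := enum_val i : {set G}.
(* The index counts right cosets; inverting their representatives yields representatives of the left
   cosets. *)
exists (fun i => (repr (B i))^-1%g).
have repB i : B i = H :* repr (B i).
  by have /rcosetsP[x _ defB] := enum_valP i; rewrite /B defB rcoset_repr.
(* By Lagrange both sides have the same cardinality, so injectivity suffices. *)
apply: inj_card_bij; last first.
  rewrite card_prod card_ord -cardsT -(Lagrange (subsetT H)) mulnC.
  by rewrite [#|{: subg_of H}|]card_sub leq_mul.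
move=> [i h] [j k] /= eq_ih.
have eq_ij : i = j.
  apply: enum_val_inj; change (B i = B j).
  rewrite repB [RHS]repB; apply: rcoset_eqP; rewrite mem_rcoset.
  have -> : repr (B i) = (sgval h * (sgval k)^-1 * repr (B j))%g.
    apply: (mulgI (repr (B i))^-1%g); apply: (mulIg (repr (B j))^-1%g).
    by rewrite mulVg mul1g !mulgA mulgK eq_ih mulgK.
  by rewrite mulgK groupM ?groupV ?subgP.
by move: eq_ih; rewrite eq_ij => /mulgI/subg_inj->.
Qed.

End Transversal.

(** * Characters and their first orthogonality relation *)

Section Characters.

Variables (C : numClosedFieldType) (K : finGroupType).
Implicit Types (chi psi : dual C K) (x y : K).

Lemma dual_mulV chi x : chi x * chi x^-1%g = 1.
Proof. by rewrite -dualM mulgV dual1. Qed.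

Lemma dual_neq0 chi x : chi x != 0.
Proof.
by apply: contra_eq_neq (dual_mulV chi x) => ->; rewrite mul0r eq_sym oner_eq0.
Qed.

Lemma eq_dual chi psi : chi =1 psi -> chi = psi.
Proof. by move=> eq_cp; apply/val_inj/ffunP. Qed.

Lemma cardG_neq0 : #|K|%:R != 0 :> C.
Proof. by rewrite pnatr_eq0 -lt0n; apply/card_gt0P; exists 1%g. Qed.

Lemma dual_mul_subproof chi psi : is_char [ffun x => chi x * psi x].
Proof.
rewrite /is_char ffunE !dual1 mulr1 eqxx; apply/forallP=> x; apply/forallP=> y.
by rewrite !ffunE !dualM mulrACA.
Qed.

Definition dual_mul chi psi := Dual (dual_mul_subproof chi psi).

Lemma dual_mulE chi psi x : dual_mul chi psi x = chi x * psi x.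
Proof. by rewrite ffunE. Qed.

Lemma dual_mulI chi : injective (dual_mul chi).
Proof.
move=> psi1 psi2 eq_psi; apply: eq_dual => x; apply: (mulfI (dual_neq0 chi x)).
by rewrite -!dual_mulE eq_psi.
Qed.

Lemma dual_orth_row chi psi :
  \sum_x chi x * psi x^-1%g = #|K|%:R * (chi == psi)%:R.
Proof.
case: eqVneq => [->|neq]; rewrite ?(mulr1, mulr0).
  by rewrite (eq_bigr (fun=> 1)) => [|x _]; rewrite ?dual_mulV // sumr_const.
have [y neq_y]: exists y, chi y != psi y.
  apply/existsP; apply: contraR neq; rewrite negb_exists => /forallP eq_y.
  by apply/eqP/eq_dual=> y; apply/eqP; rewrite -[_ == _]negbK.
set s := \sum_x _.
(* Translating the summation variable by y multiplies s by a factor other than 1, hence s = 0. *)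
have: chi y * psi y^-1%g * s = s.
  rewrite mulr_sumr [in RHS]/s [RHS](reindex_inj (mulgI y)) /=.
  apply: eq_bigr => x _; rewrite invMg !dualM.
  by rewrite mulrACA (mulrC (psi x^-1%g)).
move/eqP; rewrite -subr_eq0 -[X in _ - X]mul1r -mulrBl mulf_eq0.
case/orP=> /eqP // /(congr1 ( *%R^~ (psi y))).
rewrite mul0r mulrBl mul1r -mulrA [psi _ * _]mulrC dual_mulV mulr1.
by move/eqP; rewrite subr_eq0 (negPf neq_y).
Qed.

Definition char_table : 'M[C]_(#|{: dual C K}|, #|K|) :=
  \matrix_(i, j) (enum_val i : dual C K) (enum_val j).

Definition char_tableV : 'M[C]_(#|K|, #|{: dual C K}|) :=
  \matrix_(j, i) ((enum_val i : dual C K) (enum_val j)^-1%g / #|K|%:R).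

(** Only a right inverse so far: the table is not yet known to be square. *)
Lemma mul_char_tableV : char_table *m char_tableV = 1%:M.
Proof.
apply/matrixP=> i j; rewrite !mxE.
under eq_bigr do rewrite !mxE mulrA.
rewrite -mulr_suml (reindex _ (onW_bij _ (enum_rank_bij K))) /=.
under eq_bigr do rewrite !enum_rankK.
by rewrite dual_orth_row (inj_eq enum_val_inj) mulrAC divff ?cardG_neq0 ?mul1r.
Qed.

(** * Completeness of the characters of an abelian group *)

Section Abelian.

Hypothesis abelK : commutative (@mulg K).

(** The right regular representation, acting on row vectors. *)
Definition trans_mx x : 'M[C]_#|K| :=
  \matrix_(i, j) (enum_val j == enum_val i * x)%g%:R.

Lemma row_trans_mx (v : 'rV_#|K|) x y :
  (v *m trans_mx x) 0 (enum_rank (y * x)%g) = v 0 (enum_rank y).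
Proof.
rewrite mxE (bigD1 (enum_rank y)) //= mxE !enum_rankK eqxx mulr1.
rewrite big1 ?addr0 // => i neq_i; rewrite mxE enum_rankK (inj_eq (mulIg x)).
by rewrite -(can2_eq enum_rankK enum_valK) eq_sym (negPf neq_i) mulr0.
Qed.

Lemma trans_mxM x y : trans_mx (x * y)%g = trans_mx x *m trans_mx y.
Proof.
apply/row_matrixP=> i; rewrite row_mul; apply/rowP=> j.
rewrite -[j]enum_valK -[enum_val j](mulgKV y) row_trans_mx !mxE !enum_rankK.
by rewrite mulgA (inj_eq (mulIg y)).
Qed.

Lemma trans_mx1 : trans_mx 1%g = 1%:M.
Proof.
by apply/matrixP=> i j; rewrite !mxE mulg1 (inj_eq enum_val_inj) eq_sym.
Qed.

Lemma trans_mx_diagonalizable x : diagonalizable (trans_mx x).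
Proof.
apply: (@finite_order_diagonalizable _ #|K|).
  by apply/card_gt0P; exists 1%g.
have -> k : iter k (mulmx (trans_mx x)) 1%:M = trans_mx (x ^+ k)%g; last first.
  by have -> : (x ^+ #|K| = 1)%g; rewrite ?trans_mx1 // -cardsT expg_cardG ?inE.
by elim: k => [|k IHk]; rewrite ?trans_mx1 //= IHk -trans_mxM expgS.
Qed.

(* The rows of a basis that diagonalises all translations simultaneously are
   multiples of characters. *)
Lemma row_full_char_table : row_full char_table.
Proof.
have [V Vu /allP diagV] : codiagonalizable [seq trans_mx x | x <- enum K].
  apply/codiagonalizableP; split=> [_ _ /mapP[x _ ->] /mapP[y _ ->]|].
    by rewrite /comm_mx -!trans_mxM abelK.
  by move=> _ /mapP[x _ ->]; apply: trans_mx_diagonalizable.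
have {diagV} eigV x : {d | V *m trans_mx x = diag_mx d *m V}.
  have /diagV/= : trans_mx x \in [seq trans_mx x | x <- enum K].
    by apply: map_f; rewrite mem_enum.
  by case/diagonalizable_forPex/sigW=> d /(simmxP Vu) eqV; exists d.
suff V_sub : (V <= char_table)%MS.
  by rewrite -sub1mx (submx_trans _ V_sub) // sub1mx row_full_unit.
(* Each row of V is a common eigenvector, with eigenvalue [c x] under translation by x. *)
apply/row_subP=> i; pose v := row i V; pose c x := sval (eigV x) 0 i.
have vM x y : c x * v 0 (enum_rank (y * x)%g) = v 0 (enum_rank y).
  rewrite -(row_trans_mx v x y) /v -row_mul (svalP (eigV x)) row_mul.
  by rewrite row_diag_mx -scalemxAl -rowE [RHS]mxE.
(* Vanishing at 1 would spread to all of K by [vM], giving the invertible V a zero row. *)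
have c1_neq0 : v 0 (enum_rank 1%g) != 0.
  apply: contra_neq (oner_neq0 C) => v1.
  have v0 : v = 0.
    apply/rowP=> j; rewrite -[j]enum_valK -[enum_val j]invgK.
    by rewrite -(vM (enum_val j)^-1%g) mulVg v1 mulr0 mxE.
  have /matrixP/(_ i i) := mulmxV Vu; rewrite !mxE eqxx mulr1n => <-.
  rewrite big1 // => j _; have /rowP/(_ j) := v0.
  by rewrite !mxE => ->; rewrite mul0r.
have c_neq0 x : c x != 0.
  by apply: contraNneq c1_neq0 => cx; rewrite -(vM x) cx mul0r.
have vE x : v 0 (enum_rank x) = v 0 (enum_rank 1%g) * (c x)^-1.
  by rewrite -(vM x 1%g) mul1g mulrAC divff // mul1r.
have cM x y : c (x * y)%g = c x * c y.
  apply: (mulIf (invr_neq0 (c_neq0 (x * y)%g))); rewrite divff //.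
  apply: (mulfI c1_neq0); rewrite mulr1 mulrCA -vE -{1}(vM x 1%g) mul1g.
  by rewrite -mulrA; congr (_ * _); rewrite -(vM y).
(* By [vE] the row is its value at 1 times the inverse eigenvalues, so the latter form the character
   sought. *)
have chiP : is_char [ffun x => (c x)^-1].
  rewrite /is_char; apply/andP; split.
    by rewrite ffunE -(inj_eq (mulfI c1_neq0)) -vE mulr1.
  by apply/forallP=> x; apply/forallP=> y; rewrite !ffunE cM invfM.
suff -> : row i V =
    v 0 (enum_rank 1%g) *: row (enum_rank (Dual chiP)) char_table.
  exact/scalemx_sub/row_sub.
by apply/rowP=> j; rewrite -[j]enum_valK vE !mxE enum_rankK enum_valK /= ffunE.
Qed.

(** Full rank supplies a left inverse, which must coincide with the right inverse. *)
Lemma mulV_char_table : char_tableV *m char_table = 1%:M.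
Proof.
have /row_fullP[B BT] := row_full_char_table.
suff <- : B = char_tableV by [].
by rewrite -[LHS]mulmx1 -mul_char_tableV mulmxA BT mul1mx.
Qed.

Lemma card_dual : #|{: dual C K}| = #|K|.
Proof.
apply/eqP; rewrite eqn_leq.
by rewrite (mulmx1_min mulV_char_table) (mulmx1_min mul_char_tableV).
Qed.

Lemma dual_orth_col x y :
  \sum_(chi : dual C K) chi x^-1%g * chi y = #|K|%:R * (x == y)%:R.
Proof.
have /matrixP/(_ (enum_rank x) (enum_rank y)) := mulV_char_table.
rewrite !mxE (inj_eq enum_rank_inj) => <-.
rewrite mulr_sumr (reindex _ (onW_bij _ (enum_val_bij (dual C K)))).
apply: eq_bigr => i _; rewrite !mxE !enum_rankK mulrA mulrCA divff ?mulr1 //.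
exact: cardG_neq0.
Qed.

(** * Evaluation of group algebra elements at characters *)

Section Evaluation.

Variable A : comAlgType C.
Implicit Types f g : galg A K.

Definition galg_eval chi f : A := \sum_x chi x *: f x.

Lemma galg_evalM chi : {morph galg_eval chi : f g / f * g}.
Proof.
move=> f g; rewrite /galg_eval mulr_suml.
under eq_bigr do rewrite ffunE scaler_sumr.
rewrite exchange_big; apply: eq_bigr => x _ /=.
rewrite mulr_sumr (reindex_inj (mulgI x)); apply: eq_bigr => y _ /=.
by rewrite mulKg dualM -scalerAl -scalerAr scalerA.
Qed.

Lemma galg_eval1 chi : galg_eval chi (gelt A 1%g) = 1.
Proof.
rewrite /galg_eval (bigD1 1%g) //= dual1 ffunE eqxx scale1r big1 ?addr0 // => x.
by rewrite ffunE => /negPf->; rewrite scaler0.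
Qed.

Lemma galg_evalZ chi (a : A) f : galg_eval chi (a *: f) = a * galg_eval chi f.
Proof.
by rewrite /galg_eval mulr_sumr; apply: eq_bigr => x _; rewrite ffunE -scalerAr.
Qed.

(** Fourier inversion [fE] recovers each coefficient from the values at characters, so identities in
    the group algebra can be tested there. *)
Lemma galg_eval_inj f g :
  (forall chi, galg_eval chi f = galg_eval chi g) -> f = g.
Proof.
suff fE (h : galg A K) x :
    #|K|%:R *: h x = \sum_(chi : dual C K) chi x^-1%g *: galg_eval chi h.
  move=> eq_fg; apply/ffunP=> x; apply: (scalerI cardG_neq0).
  by rewrite !fE; apply: eq_bigr => chi _; rewrite eq_fg.
under eq_bigr do rewrite scaler_sumr.
rewrite exchange_big (bigD1 x) //= [X in _ + X]big1 ?addr0.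
  under eq_bigr do rewrite scalerA.
  by rewrite -scaler_suml dual_orth_col eqxx mulr1.
move=> y y_neq_x; under eq_bigr do rewrite scalerA.
by rewrite -scaler_suml dual_orth_col eq_sym (negPf y_neq_x) mulr0 scale0r.
Qed.

End Evaluation.

End Abelian.
End Characters.

(** * The determinants D_chi and the factorisation of the group determinant *)

Section Main.

Variables (C : numClosedFieldType) (G : finGroupType) (H : {group G}).
Hypothesis abelH : abelian H.
Local Notation K := (subg_of H).
Local Notation m := #|[set: G] : H|.
Implicit Types (chi psi : dual C K) (h k : K).

Lemma subg_commutative : commutative (@mulg K).
Proof.
by move=> h k; apply: subg_inj; apply: (centsP abelH); apply: subgP.
Qed.

Section Det.

Variable t : 'I_m -> G.
Hypothesis bij_t : bijective (fun p : 'I_m * K => t p.1 * sgval p.2)%g.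

Definition char_mx chi : 'M[{mpoly C[#|G|]}]_m :=
  \matrix_(i, j) \sum_h chi h *: gvar C (t i * sgval h * (t j)^-1)%g.

Section Factorization.

(** Characters are numbered by the same indices as elements of H, which makes the block character
    table square. *)
Let e (i : 'I_#|K|) : dual C K :=
  enum_val (cast_ord (esym (card_dual C subg_commutative)) i).

Let e_bij : bijective e.
Proof.
apply: bij_comp (enum_val_bij _) _.
by exists (cast_ord (card_dual C subg_commutative)) => i;
  rewrite cast_ord_comp cast_ord_id.
Qed.

Let N : 'M[{mpoly C[#|G|]}]_(\sum_(a < #|K|) m) :=
  \mxblock_(a < #|K|, b < #|K|) \matrix_(i < m, j < m)
    gvar C (t i * sgval (enum_val a) * (t j * sgval (enum_val b))^-1)%g.

(** Kronecker product of the character table, taken at inverses, with the identity of size m; [F']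
    is its inverse by column orthogonality. *)
Let F : 'M[{mpoly C[#|G|]}]_(\sum_(a < #|K|) m) :=
  \mxblock_(b < #|K|, c < #|K|) ((e c (enum_val b)^-1%g)%:MP%:M : 'M_m).

Let F' : 'M[{mpoly C[#|G|]}]_(\sum_(a < #|K|) m) :=
  \mxblock_(c < #|K|, b < #|K|) ((e c (enum_val b) / #|K|%:R)%:MP%:M : 'M_m).

Let FF' : F *m F' = 1%:M.
Proof.
rewrite mul_mxblock -mxdiagZ; apply: eq_mxblock => a b.
under eq_bigr do rewrite -scalar_mxM -mpolyCM mulrA.
rewrite -!raddf_sum /= -mulr_suml.
have := dual_orth_col C subg_commutative (enum_val a) (enum_val b).
rewrite (reindex _ (onW_bij _ e_bij)) /= => ->.
rewrite (inj_eq enum_val_inj) mulrAC divff ?cardG_neq0 // mul1r.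
by case: eqP => _; rewrite ?conform_mx_id ?mpolyC1 ?mpolyC0 ?raddf0.
Qed.

Let detN : \det N = group_det C G.
Proof.
(* Position i of block a stands for the element t_i h_a of G. *)
pose f (s : 'I_(\sum_(a < #|K|) m)) : 'I_#|G| :=
  enum_rank (t (tagnat.sig2 s) * sgval (enum_val (tagnat.sig1 s)))%g.
have bij_f : bijective f.
  pose g (u : {a : 'I_#|K| & 'I_m}) := (tagged u, enum_val (tag u) : K).
  have bij_g : bijective g.
    exists (fun p : 'I_m * K => Tagged (fun=> 'I_m) (i := enum_rank p.2) p.1).
      by case=> a i; rewrite /g /= enum_valK.
    by case=> i h; rewrite /g /= enum_rankK.
  have bij_gsig := bij_comp bij_g tagnat.sig_bij.
  exact: bij_comp (enum_rank_bij _) (bij_comp bij_t bij_gsig).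
rewrite /group_det -(det_mxsub_bij _ bij_f); congr (\det _).
by apply/matrixP=> s s'; rewrite !mxE !enum_rankK.
Qed.

Lemma group_det_factor :
  group_det C G = \prod_(chi : dual C K) \det (char_mx chi).
Proof.
have NF : N *m F = F *m \mxdiag_(c < #|K|) char_mx (e c).
  rewrite mul_mxblock mul_mxblock_mxdiag; apply: eq_mxblock => a c.
  rewrite mul_scalar_mx; apply/matrixP=> i j; rewrite mxE summxE [in RHS]mxE.
  rewrite mulr_sumr.
  under eq_bigr do rewrite mul_mx_scalar !mxE.
  rewrite (reindex _ (onW_bij _ (enum_rank_bij K))) /=.
  (* Substituting h = a b^-1 gives chi(b^-1) = chi(a^-1) chi(h), and chi(a^-1) is the entry of F. *)
  rewrite (reindex_inj invg_inj) /= (reindex_inj (mulgI (enum_val a)^-1%g)) /=.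
  apply: eq_bigr => h _; rewrite enum_rankK invgK !mul_mpolyC scalerA -dualM.
  congr (_ *: gvar C _).
  by rewrite /= invMg invgK !mulgA mulgK.
have detF : \det F != 0.
  by apply: contra_eq_neq (congr1 (fun A => \det A) FF') => F0;
    rewrite det_mulmx F0 mul0r det1 eq_sym oner_neq0.
apply: (@mulIf {mpoly C[#|G|]} (\det F) detF).
rewrite -detN -det_mulmx NF det_mulmx mulrC.
by rewrite (reindex _ (onW_bij _ e_bij)) /= det_mxdiag.
Qed.

End Factorization.

(** * The coefficients a_h *)

Definition det_coef h : {mpoly C[#|G|]} :=
  #|K|%:R^-1 *: \sum_(chi : dual C K) chi h^-1%g *: \det (char_mx chi).

Lemma sum_det_coef chi : \sum_h chi h *: det_coef h = \det (char_mx chi).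
Proof.
under eq_bigr do rewrite scalerA mulrC -scalerA scaler_sumr.
rewrite -scaler_sumr exchange_big (bigD1 chi) //= [X in _ + X]big1 ?addr0.
  under eq_bigr do rewrite scalerA.
  rewrite -scaler_suml dual_orth_row eqxx mulr1 scalerA mulVf ?scale1r //.
  exact: cardG_neq0.
move=> psi neq; under eq_bigr do rewrite scalerA.
by rewrite -scaler_suml dual_orth_row eq_sym (negPf neq) mulr0 scale0r.
Qed.

Lemma group_det_galg :
  group_det C G *: gelt {mpoly C[#|G|]} (1%g : K) =
    \prod_(chi : dual C K)
      \sum_h (chi h *: det_coef h) *: gelt {mpoly C[#|G|]} h.
Proof.
apply: (galg_eval_inj subg_commutative) => psi.
rewrite galg_evalZ galg_eval1 mulr1.
rewrite (big_morph _ (galg_evalM psi) (galg_eval1 _ psi)).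
(* Multiplication by psi permutes the characters. *)
rewrite group_det_factor (reindex_inj (dual_mulI (chi := psi))) /=.
apply: eq_bigr => chi _; rewrite -sum_det_coef /galg_eval.
have sumE : \sum_h (chi h *: det_coef h) *: gelt {mpoly C[#|G|]} h =
    [ffun h => chi h *: det_coef h] :> galg _ K.
  by rewrite [RHS]galg_sum_gelt; apply: eq_bigr => h _; rewrite ffunE.
rewrite sumE; apply: eq_bigr => h _.
by rewrite dual_mulE ffunE [RHS]scalerA.
Qed.

Lemma det_coef_homog h : det_coef h \is m.-homog.
Proof.
apply/rpredZ/rpred_sum => chi _; apply/rpredZ; apply: det_homog => i j.
by rewrite mxE; apply: rpred_sum => k _; rewrite rpredZ // dhomogX /= mdeg1.
Qed.

Lemma eq_transversal i j (k l : K) :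
  (t i * sgval k == t j * sgval l)%g = (i == j) && (k == l).
Proof. exact: (inj_eq (bij_inj bij_t) (i, k) (j, l)). Qed.

(** The representative of the coset H itself commutes with H, which keeps the count in
    [det_coef_neq0] positive. *)
Lemma transversal_meets : exists i, t i \in H.
Proof.
have [dec _ decK] := bij_t; exists (dec 1%g).1.
by rewrite -(mulgK (sgval (dec 1%g).2) (t _)) decK mul1g groupV subgP.
Qed.

Lemma det_coef_neq0 h : det_coef h != 0.
Proof.
(* [P chi] is M_chi at x_h = 1 with all other variables 0. At x_1 = 1 alone M_chi is the identity,
   so by linearity [v u] turns it into u minus [P chi], even when h = 1. *)
pose P chi : 'M[C]_m :=
  \matrix_(i, j) \sum_k chi k * (t i * sgval k * (t j)^-1 == sgval h)%g%:R.
pose v (u : C) (i : 'I_#|G|) :=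
  u * (enum_val i == 1%g)%:R - (enum_val i == sgval h)%:R.
have evD u chi : (\det (char_mx chi)).@[v u] = (char_poly (P chi)).[u].
  rewrite horner_char_poly -det_map_mx; congr (\det _).
  apply/matrixP=> i j; rewrite !mxE raddf_sum /=.
  under eq_bigr do rewrite mevalZ mevalXU /v enum_rankK mulrBr.
  rewrite sumrB; congr (_ - _).
  rewrite (bigD1 1%g) //= big1 ?addr0 => [|k k_neq1].
    rewrite dual1 mul1r -eq_mulgV1 mulg1 mulr_natr.
    by have := eq_transversal i j 1%g 1%g; rewrite /= !mulg1 eqxx andbT => ->.
  rewrite -(eq_mulgV1 (t i * sgval k)%g (t j)).
  have := eq_transversal i j k 1%g; rewrite /= mulg1 => ->.
  by rewrite (negPf k_neq1) andbF !mulr0.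
(* As a polynomial in u, [q] is |K| times the specialisation of a_h. *)
pose q := \sum_(chi : dual C K) chi h^-1%g *: char_poly (P chi).
apply/negP=> /eqP a_h0.
have q0 : q = 0.
  apply: poly_eq0_horner => u; rewrite -[RHS](meval0 (v u)).
  rewrite -(scaler0 _ #|K|%:R) -a_h0 /det_coef scalerA divff ?cardG_neq0 //.
  rewrite scale1r horner_sum raddf_sum; apply: eq_bigr => chi _ /=.
  by rewrite hornerZ mevalZ evD.
have [i0 ti0] := transversal_meets.
have m_gt0 : (0 < m)%N by apply: indexg_gt0.
pose fix_h := [pred i | t i * sgval h * (t i)^-1 == sgval h]%g.
(* This coefficient of a characteristic polynomial is minus the trace; summing over chi, column
   orthogonality leaves only k = h in each diagonal entry. *)
have : q`_m.-1 = - (#|K| * #|fix_h|)%:R.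
  rewrite coef_sum; under eq_bigr do rewrite coefZ char_poly_trace // mulrN.
  rewrite sumrN; congr (- _).
  under eq_bigr do rewrite mulr_sumr.
  rewrite exchange_big natrM -[#|fix_h|]sum1_card natr_sum [RHS]mulr_sumr.
  rewrite [RHS]big_mkcond /=; apply: eq_bigr => i _.
  under eq_bigr do rewrite mxE mulr_sumr.
  rewrite exchange_big (bigD1 h) //= [X in _ + X]big1 ?addr0 => [|k k_neq].
    under eq_bigr do rewrite mulrA.
    rewrite -mulr_suml dual_orth_col ?eqxx; last exact: subg_commutative.
    by rewrite inE; case: eqP; rewrite ?(mulr1, mulr0).
  under eq_bigr do rewrite mulrA.
  rewrite -mulr_suml dual_orth_col; last exact: subg_commutative.
  by rewrite eq_sym (negPf k_neq) mulr0 mul0r.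
rewrite q0 coef0 => /esym/eqP; rewrite oppr_eq0 pnatr_eq0 muln_eq0.
case/norP; split; rewrite -lt0n; apply/card_gt0P.
  by exists 1%g.
by exists i0; rewrite inE (centsP abelH _ ti0 _ (subgP h)) mulgK.
Qed.

(** * Conjugation invariance when H is normal *)

Section Normal.

Hypothesis nHG : H <| [set: G].
Variable g : G.

Let memJ h : (sgval h ^ g)%g \in H.
Proof. by rewrite memJ_norm ?subgP // (subsetP (normal_norm nHG)) ?inE. Qed.

Let memJV h : (sgval h ^ g^-1)%g \in H.
Proof. by rewrite memJ_norm ?subgP // (subsetP (normal_norm nHG)) ?inE. Qed.

(** Outside H [subg] would return a default value; normality, through [memJ], excludes this. *)
Definition subgJ h : K := subg H (sgval h ^ g)%g.

Lemma subgJE h : sgval (subgJ h) = (sgval h ^ g)%g.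
Proof. exact: subgK. Qed.

Lemma subgJM : {morph subgJ : h k / (h * k)%g}.
Proof. by move=> h k; apply: subg_inj; rewrite /= !subgJE conjMg. Qed.

Lemma subgJ_bij : bijective subgJ.
Proof.
exists (fun h => subg H (sgval h ^ g^-1)%g) => h; apply: subg_inj.
  by rewrite subgK subgJE ?conjgK ?subgP.
by rewrite subgJE subgK ?conjgKV ?memJV.
Qed.

Lemma dualJ_subproof chi : is_char [ffun h => chi (subgJ h)].
Proof.
rewrite /is_char ffunE; apply/andP; split.
  by have -> : subgJ 1%g = 1%g; rewrite ?dual1 //; apply: subg_inj;
    rewrite subgJE conj1g.
by apply/forallP=> h; apply/forallP=> k; rewrite !ffunE subgJM dualM.
Qed.

Definition dualJ chi := Dual (dualJ_subproof chi).

Lemma dualJE chi h : dualJ chi h = chi (subgJ h).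
Proof. by rewrite ffunE. Qed.

Lemma dualJ_inj : injective dualJ.
Proof.
move=> chi psi eqJ; have [f _ fK] := subgJ_bij.
by apply: eq_dual => h; rewrite -[h]fK -!dualJE eqJ.
Qed.

(** Writing t_i g = t_(p i) s_i with s_i in H, conjugating chi permutes rows and columns of M_chi by
    p and scales row i by chi(s_i)^-1 and column j by chi(s_j); these factors cancel in the
    determinant. *)
Lemma det_char_mxJ chi : \det (char_mx (dualJ chi)) = \det (char_mx chi).
Proof.
have [dec _ decK] := bij_t.
pose p i := (dec (t i * g)%g).1; pose s i := (dec (t i * g)%g).2.
have tE i : (t i * g = t (p i) * sgval (s i))%g by rewrite -(decK (t i * g)%g).
(* If p i = p j, then t_i = t_j k with k conjugate to s_j^-1 s_i, so k lies in H by normality and i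
   = j. *)
have inj_p : injective p.
  move=> i j eq_p.
  pose k := subg H (sgval ((s j)^-1 * s i) ^ g^-1)%g.
  have : (t i * sgval (1%g : K) == t j * sgval k)%g.
    rewrite /k subgK ?memJV // mulg1 conjgE invgK /= !mulgA tE.
    by rewrite mulgK -eq_p -tE mulgK.
  by rewrite eq_transversal => /andP[/eqP].
pose d (f : 'I_m -> C) : 'M[{mpoly C[#|G|]}]_m := diag_mx (\row_i (f i)%:MP).
have -> : char_mx (dualJ chi) =
    d (fun i => chi (s i)^-1%g) *m mxsub p p (char_mx chi) *m d (chi \o s).
  apply/matrixP=> i j; rewrite mul_mx_diag mul_diag_mx !mxE.
  rewrite mulr_sumr mulr_suml.
  rewrite [RHS](reindex_inj (mulgI (s i))).
  rewrite [RHS](reindex_inj (mulIg (s j)^-1%g)).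
  rewrite [RHS](reindex _ (onW_bij _ subgJ_bij)) /=; apply: eq_bigr => k _.
  rewrite dualJE mul_mpolyC mulrC mul_mpolyC !scalerA; congr (_ *: gvar C _).
    by rewrite -!dualM -!mulgA mulKg subg_commutative mulgKV.
  apply: (mulIg (t (p j) * sgval (s j))%g).
  by rewrite subgJE conjgE -{1}tE !mulgA !mulgKV -tE mulgK.
rewrite !det_mulmx (det_mxsub_bij _ (injF_bij inj_p)) mulrAC -det_mulmx.
suff -> : d (fun i => chi (s i)^-1%g) *m d (chi \o s) = 1%:M.
  by rewrite det1 mul1r.
rewrite mulmx_diag -diag_const_mx; congr diag_mx.
by apply/rowP=> i; rewrite !mxE -mpolyCM mulrC dual_mulV.
Qed.

Lemma det_coefJ h : det_coef (subgJ h) = det_coef h.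
Proof.
congr (_ *: _); rewrite [RHS](reindex_inj dualJ_inj) /=.
apply: eq_bigr => chi _; rewrite det_char_mxJ dualJE; congr (chi _ *: _).
by apply: subg_inj; rewrite subgJE /= subgJE conjVg.
Qed.

End Normal.

End Det.
End Main.

Theorem theorem5 (R : realType) (G : finGroupType) (H : {group G})
    (abelH : abelian H) :
  exists a : subg_of H -> {mpoly R[i][#|G|]},
    [/\ forall h : subg_of H,
          a h \is #|[set: G] : H|.-homog /\ msize (a h) = #|[set: G] : H|.+1,
        group_det R[i] G *: gelt {mpoly R[i][#|G|]} (1%g : subg_of H) =
        \prod_(chi : dual R[i] (subg_of H))
          \sum_(h : subg_of H) (chi h *: a h) *: gelt {mpoly R[i][#|G|]} h
      & H <| [set: G] ->
        forall h h' : subg_of H, sgval h' \in sgval h ^: [set: G] ->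
          a h = a h'].
Proof.
have [t bij_t] := transversal_exists H.
exists (det_coef R[i] t); split=> [h||nHG h h' /imsetP[g _ def_h']].
- have homh := det_coef_homog R[i] t h; split=> //.
  by apply: msize_homog => //; apply: det_coef_neq0.
- exact: group_det_galg.
rewrite -(det_coefJ _ abelH bij_t nHG g); congr (det_coef _ t _).
by apply: subg_inj; rewrite subgJE.
Qed.
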